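(* Let $K$ be a complete discrete valuation field whose residue field $k_K$ has characteristic $p>0$ and satisfies $|k_K:k_K^p|<\infty$. Let $L/K$ be a finite Galois well ramified $p$-extension, and put $K_0=L\cap K_{\mathrm{ur}}$, where $K_{\mathrm{ur}}$ is the maximal unramified extension of $K$. Then there is a Galois subextension $T/K_0$ of $L/K_0$ such that $T/K_0$ is in case I and $L/T$ is in case II.
   Context: For a finite extension $L/K$ of complete discrete valuation fields, $\mathcal{O}_L$ is the valuation ring and $k_L$ the residue field of $L$. A finite Galois $p$-extension $L/K$ is well ramified if $\mathcal{O}_L=\mathcal{O}_K[\alpha]$ for some $\alpha\in L$. An extension $L/K$ is in case I if $k_L/k_K$ is separable; it is in case II if $|L:K|=|k_L:k_K|$ and $k_L=k_K(a)$ for some $a$, purely inseparable over $k_K$. *)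

(* Defs.v *)
From HB Require Import structures.
From mathcomp Require Import all_boot all_order all_algebra all_fingroup all_solvable all_field.
Set Implicit Arguments. Unset Strict Implicit. Unset Printing Implicit Defensive.
Import Order.TTheory GRing.Theory Num.Theory.
Local Open Scope ring_scope.

(* Setting: K is the base field F, embedded in L as the subfield 1%AS; the
   extension L/K is a finite extension (L : splittingFieldType F); all
   intermediate fields are subfields E : {subfield L}.  The (normalized)
   discrete valuation of L is v : L -> int, meaningful only on nonzero
   elements (v 0 is irrelevant). *)

Section Val.
Variables (F : fieldType) (L : fieldExtType F).

Definition is_dvaluation (v : L -> int) : Prop :=
  [/\ forall x y, x != 0 -> y != 0 -> v (x * y) = v x + v y,
      forall x y, x != 0 -> y != 0 -> x + y != 0 ->
        Num.min (v x) (v y) <= v (x + y)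
    & exists x, x != 0 /\ v x = 1].

Definition inO (v : L -> int) (E : {vspace L}) (x : L) : bool :=
  (x \in E) && ((x == 0) || (0 <= v x)).
Definition inM (v : L -> int) (E : {vspace L}) (x : L) : bool :=
  (x \in E) && ((x == 0) || (0 < v x)).

Definition complete_sub (v : L -> int) (E : {vspace L}) : Prop :=
  forall u : nat -> L, (forall n, u n \in E) ->
    (forall N : int, exists n0, forall m n, (n0 <= m)%N -> (n0 <= n)%N ->
        (u m - u n == 0) || (N <= v (u m - u n))) ->
    exists2 l, l \in E &
      forall N : int, exists n0, forall n, (n0 <= n)%N ->
        (u n - l == 0) || (N <= v (u n - l)).

(* |k_E : k_E^p| < oo : k_E is spanned over k_E^p by finitely many elements *)
Definition res_pdeg_finite (v : L -> int) (p : nat) (E : {vspace L}) : Prop :=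
  exists s : seq L, all (inO v E) s /\
    forall x, inO v E x -> exists a : seq L,
      [/\ size a = size s, all (inO v E) a &
          inM v E (x - \sum_(i < size s) a`_i ^+ p * s`_i)].

Definition res_free (v : L -> int) (E E' : {vspace L}) (s : seq L) : Prop :=
  all (inO v E') s /\
  forall a : seq L, size a = size s -> all (inO v E) a ->
    inM v E' (\sum_(i < size s) a`_i * s`_i) -> all (inM v E) a.

Definition res_degree (v : L -> int) (E E' : {vspace L}) (n : nat) : Prop :=
  (exists s, size s = n /\ res_free v E E' s) /\
  (forall s, res_free v E E' s -> (size s <= n)%N).

Definition polyO (v : L -> int) (E : {vspace L}) (f : {poly L}) : Prop :=
  forall i, inO v E f`_i.
Definition polyM (v : L -> int) (E : {vspace L}) (f : {poly L}) : Prop :=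
  forall i, inM v E f`_i.

(* k_E'/k_E separable: each residue is a root of a separable polynomial
   over k_E (the reduction of a monic f over O_E, coprime to its derivative
   modulo m_E) *)
Definition res_separable (v : L -> int) (E E' : {vspace L}) : Prop :=
  forall x, inO v E' x -> exists f : {poly L},
    [/\ polyO v E f, f \is monic, inM v E' f.[x] &
        exists g h : {poly L}, [/\ polyO v E g, polyO v E h &
          polyM v E (g * f + h * f^`() - 1)]].

Definition res_purely_insep_gen (v : L -> int) (p : nat) (E E' : {vspace L}) : Prop :=
  exists a, [/\ inO v E' a,
    (exists n b, inO v E b /\ inM v E' (a ^+ (p ^ n) - b)) &
    forall x, inO v E' x -> exists f : {poly L}, polyO v E f /\ inM v E' (x - f.[a])].

Definition caseI (v : L -> int) (E E' : {vspace L}) : Prop := res_separable v E E'.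
Definition caseII (v : L -> int) (p : nat) (E E' : {vspace L}) : Prop :=
  res_degree v E E' (\dim_E E') /\ res_purely_insep_gen v p E E'.

Definition unramified (v : L -> int) (E E' : {vspace L}) : Prop :=
  res_degree v E E' (\dim_E E') /\ res_separable v E E'.

Definition well_ramified (v : L -> int) (K E : {vspace L}) : Prop :=
  exists alpha, inO v E alpha /\ alpha \in E /\
    forall x, inO v E x -> exists f : {poly L}, polyO v K f /\ x = f.[alpha].

End Val.

(* Main.v *)
Require Import Defs.
From HB Require Import structures.
From mathcomp Require Import all_boot all_order all_algebra all_fingroup all_solvable all_field.
From mathcomp Require Import zify ring.
From Stdlib Require Import Classical IndefiniteDescription.
Import Order.TTheory GRing.Theory Num.Theory.
Set Implicit Arguments. Unset Strict Implicit. Unset Printing Implicit Defensive.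
Local Open Scope ring_scope.

(* Write O_L = O_K[alpha].  The inertia group I = {s | s alpha = alpha mod m_L} is
   such that the residue of N_I(alpha) has |G : I| distinct conjugates and generates
   a separable residue extension, so L^I is unramified over K and is contained in K0;
   hence Gal(L/K0) acts trivially on k_L, and k_L = k_K0(a) with a the residue of
   alpha and a^(p^t) the first p-power of a lying in k_K0.

   The claim is that every subgroup H of Gal(L/K0) of order p^j <= p^t satisfies
   [k_L : k_(L^H)] = |H|, so that T = L^H for H normal of order p^t works: L/T is in
   case II, and k_T = k_K0 by counting degrees.  By induction, let H1 have index p in
   H, with the claim known for H1; if it failed for H then L^H and M = L^H1 would have
   the same residue field.  Let s be in H but not in H1, and y = N_H1(alpha).
   Now M has a uniformizer pi with v(s pi - pi) > v(s y - y) unless s pi = pi: either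
   pi lies in K0, or pi = y^(p^(t-j)) - B where B lifts a^(p^t).  But expanding elements x
   of O_M in powers of pi with coefficients in L^H shows v(s x - x) >= v(s pi - pi).  So
   s fixes pi, then all of M, contradicting the choice of s. *)

(** * Valuations and the filtration by powers of the maximal ideal *)

Section Valuation.
Variables (K : fieldType) (v : K -> int).

Definition valuation :=
  (forall x y, x != 0 -> y != 0 -> v (x * y) = v x + v y) /\
  (forall x y, x != 0 -> y != 0 -> x + y != 0 -> Num.min (v x) (v y) <= v (x + y)).

(* [v 0] is unconstrained, whence the explicit case [x == 0]. *)
Definition vge (N : int) : pred K := fun x => (x == 0) || (N <= v x).

Hypothesis hv : valuation.

Lemma vge0 N : vge N 0. Proof. by rewrite /vge eqxx. Qed.

Lemma valuation1 : v 1 = 0.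
Proof. have := hv.1 1 1 (oner_neq0 _) (oner_neq0 _); rewrite mulr1; lia. Qed.

Lemma valuationX x n : x != 0 -> v (x ^+ n) = v x *+ n.
Proof.
move=> x0; elim: n => [|n IH]; first by rewrite expr0 valuation1.
by rewrite exprS hv.1 ?expf_neq0 // IH mulrS.
Qed.

Lemma valuationV x : x != 0 -> v x^-1 = - v x.
Proof. by move=> x0; have := hv.1 x x^-1 x0; rewrite invr_eq0 divff // valuation1 => /(_ x0); lia. Qed.

Lemma valuationN x : v (- x) = v x.
Proof.
have [->|x0] := eqVneq x 0; first by rewrite oppr0.
have n0 : (-1 : K) != 0 by rewrite oppr_eq0 oner_neq0.
have := hv.1 _ _ n0 n0; rewrite mulrNN mulr1 valuation1 => h.
rewrite -mulN1r hv.1 //; lia.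
Qed.

Lemma vgeW m n x : m <= n -> vge n x -> vge m x.
Proof. by rewrite /vge => mn /orP[->//|h]; rewrite (le_trans mn h) orbT. Qed.

Lemma vgeN N x : vge N (- x) = vge N x.
Proof. by rewrite /vge oppr_eq0 valuationN. Qed.

Lemma vgeD N x y : vge N x -> vge N y -> vge N (x + y).
Proof.
rewrite /vge; have [->|x0] := eqVneq x 0; first by rewrite add0r.
have [->|y0] /= := eqVneq y 0; first by rewrite addr0 => ->; rewrite orbT.
have [//|xy0] /= := eqVneq (x + y) 0; have := hv.2 x y x0 y0 xy0.
by rewrite ge_min => /orP[] h1 h2 h3; apply: le_trans h1.
Qed.

Lemma vgeB N x y : vge N x -> vge N y -> vge N (x - y).
Proof. by move=> hx hy; rewrite vgeD ?vgeN. Qed.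

Lemma vgeBC N x y : vge N (x - y) = vge N (y - x).
Proof. by rewrite -vgeN opprB. Qed.

Lemma vge_trans N y x z : vge N (x - y) -> vge N (y - z) -> vge N (x - z).
Proof. by move=> h1 h2; rewrite -(subrKA y) vgeD. Qed.

Lemma vgeM m n x y : vge m x -> vge n y -> vge (m + n) (x * y).
Proof.
rewrite /vge mulf_eq0; have [//|x0] := eqVneq x 0; have [//|y0] := eqVneq y 0.
by move=> /= hx hy; rewrite hv.1 // lerD.
Qed.

Lemma vgeMl N x y : vge 0 x -> vge N y -> vge N (x * y).
Proof. by move=> hx hy; rewrite -[N]add0r vgeM. Qed.

Lemma vgeMr N x y : vge N x -> vge 0 y -> vge N (x * y).
Proof. by move=> hx hy; rewrite mulrC vgeMl. Qed.

Lemma vge1 : vge 0 1. Proof. by rewrite /vge valuation1 lexx orbT. Qed.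

Lemma vgeX x n : vge 0 x -> vge 0 (x ^+ n).
Proof. by move=> hx; elim: n => [|n IH]; rewrite ?expr0 ?vge1 // exprS vgeMl. Qed.

Lemma vge_sum N I r (P : pred I) (E : I -> K) :
  (forall i, P i -> vge N (E i)) -> vge N (\sum_(i <- r | P i) E i).
Proof. by move=> h; elim/big_ind: _ => //; [exact: vge0 | move=> x y; exact: vgeD]. Qed.

Lemma vge_nat n : vge 0 n%:R.
Proof. by elim: n => [|n IH]; rewrite ?vge0 // -addn1 natrD vgeD ?vge1. Qed.

Lemma vge_eq0 x : (forall n : nat, vge n%:Z x) -> x = 0.
Proof.
move=> h; apply/eqP/negPn/negP => /negPf x0.
by have := h (absz (v x)).+1; rewrite /vge x0 /=; lia.
Qed.

Lemma vge_subXX N x y n : vge 0 x -> vge 0 y -> vge N (x - y) -> vge N (x ^+ n - y ^+ n).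
Proof.
move=> hx hy h; rewrite subrXX vgeMr // vge_sum // => i _.
by rewrite vgeMl ?vgeX.
Qed.

(* Modulo the maximal ideal, [x ^+ p - y ^+ p = (x - y) * p y^(p-1)]. *)
Lemma vge_subXp N x y p : vge 1 (p%:R : K) -> 1 <= N -> vge 0 x -> vge 0 y ->
  vge N (x - y) -> vge (N + 1) (x ^+ p - y ^+ p).
Proof.
move=> hp N1 hx hy h; rewrite subrXX vgeM //.
have -> : \sum_(i < p) x ^+ (p.-1 - i) * y ^+ i
  = \sum_(i < p) (x ^+ (p.-1 - i) - y ^+ (p.-1 - i)) * y ^+ i + p%:R * y ^+ p.-1.
  have -> : p%:R * y ^+ p.-1 = \sum_(i < p) y ^+ (p.-1 - i) * y ^+ i.
    rewrite (eq_bigr (fun=> y ^+ p.-1)) ?sumr_const ?card_ord ?mulr_natl // => i _.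
    by rewrite -exprD subnK //; have := ltn_ord i; lia.
  by rewrite -big_split; apply: eq_bigr => i _ /=; rewrite -mulrDl subrK.
rewrite vgeD ?vgeMr ?vgeX // vge_sum // => i _; rewrite vgeMr ?vgeX //.
by rewrite vge_subXX // (vgeW N1).
Qed.

(** Only the last [p]-th power gains a unit of valuation; the earlier ones lose nothing. One unit is
    enough for the descent in [subgroup_indep]. *)
Lemma vge_subXpn N x y p n : vge 1 (p%:R : K) -> 1 <= N -> vge 0 x -> vge 0 y ->
  vge N (x - y) -> (0 < n)%N -> vge (N + 1) (x ^+ (p ^ n) - y ^+ (p ^ n)).
Proof.
move=> hp N1 hx hy h; case: n => // n _; rewrite expnSr !exprM.
by rewrite vge_subXp ?vgeX // vge_subXX.
Qed.

Lemma vge_inv x : vge 0 x -> ~~ vge 1 x -> vge 0 x^-1.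
Proof.
rewrite /vge negb_or -ltNge => /orP[->//|h] /andP[x0 h1].
by rewrite valuationV //; apply/orP; right; lia.
Qed.

Lemma vge_or_inv x : vge 0 x || vge 0 x^-1.
Proof.
rewrite /vge invr_eq0; have [//|x0] := eqVneq x 0; rewrite valuationV //=; lia.
Qed.

Lemma vge_div N x y : y != 0 -> vge N x -> vge (N - v y) (x / y).
Proof.
move=> y0 hx; apply: vgeM => //; by rewrite /vge valuationV // lexx orbT.
Qed.

End Valuation.

(** * The residue field as a quotient of the valuation ring *)

Section ResidueField.
Local Open Scope quotient_scope.
Variables (K : fieldType) (v : K -> int) (hv : valuation v).

(** The proof that [v] is a valuation is kept as an argument so that the subring instance declared
    below can depend on it. *)
Definition vint of valuation v : {pred K} := vge v 0.

Fact vint_subring : subring_closed (vint hv).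
Proof.
split; first exact: (vge1 hv).
- by move=> x y; exact: (vgeB hv).
- by move=> x y; exact: (vgeMl hv).
Qed.
HB.instance Definition _ := GRing.isSubringClosed.Build K (vint hv) vint_subring.

Definition vring := {x | x \in vint hv}.
HB.instance Definition _ := SubChoice.on vring.
HB.instance Definition _ := [SubChoice_isSubComNzRing of vring by <:].

Definition vmax : {pred vring} := fun x => vge v 1 (val x).

Fact vmax_idealr : idealr_closed vmax.
Proof.
split; first exact: vge0.
- by change (~~ vge v 1 (1 : K)); rewrite /vge oner_eq0 (valuation1 hv).
- move=> a x y; rewrite !unfold_in /= => hx hy.
  by rewrite (vgeD hv) ?(vgeMl hv) //; apply: (valP a).
Qed.
HB.instance Definition _ := isIdealr.Build vring vmax vmax_idealr.

Definition residue_field := {ideal_quot vmax}.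
HB.instance Definition _ := GRing.ComNzRing.on residue_field.

(* Only meaningful on integral [x]: elsewhere the value is 0. *)
Definition residue (x : K) : residue_field :=
  \pi_residue_field (odflt 0 (insub x : option vring)).
Definition residue_repr (z : residue_field) : K := val (generic_quotient.repr z).

Lemma residueE (x : vring) : residue (val x) = \pi_residue_field x.
Proof. by rewrite /residue valK. Qed.

Lemma residueEin x (hx : vge v 0 x) : residue x = \pi_residue_field (exist _ x hx : vring).
Proof. by rewrite -residueE. Qed.

Lemma vge0_residue_repr z : vge v 0 (residue_repr z).
Proof. exact: (valP (generic_quotient.repr z)). Qed.

Lemma residue_reprK z : residue (residue_repr z) = z.
Proof. by rewrite residueE generic_quotient.reprK. Qed.

Lemma residueD x y : vge v 0 x -> vge v 0 y -> residue (x + y) = residue x + residue y.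
Proof.
move=> hx hy; rewrite (residueEin hx) (residueEin hy) -[RHS]rmorphD.
by apply: etrans (residueE _); congr residue; rewrite rmorphD.
Qed.

Lemma residueM x y : vge v 0 x -> vge v 0 y -> residue (x * y) = residue x * residue y.
Proof.
move=> hx hy; rewrite (residueEin hx) (residueEin hy) -[RHS]rmorphM.
by apply: etrans (residueE _); congr residue; rewrite rmorphM.
Qed.

Lemma residue1 : residue 1 = 1.
Proof. by rewrite -[1 in LHS](rmorph1 (val : vring -> K)) residueE rmorph1. Qed.

Lemma residue_eq0 x : vge v 0 x -> (residue x == 0) = vge v 1 x.
Proof.
move=> hx; rewrite (residueEin hx) -[0](rmorph0 (\pi_residue_field)).
by rewrite -Quotient.idealrBE subr0.
Qed.

Definition residue_inv (z : residue_field) : residue_field :=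
  if z == 0 then 0 else residue (residue_repr z)^-1.

Fact residue_mulVf z : z != 0 -> residue_inv z * z = 1.
Proof.
move=> z0; rewrite /residue_inv (negPf z0) -{2}[z]residue_reprK.
have hz := vge0_residue_repr z; move: z0; rewrite -{1}[z]residue_reprK residue_eq0 // => h.
rewrite -residueM ?(vge_inv hv) // mulVf ?residue1 //.
by apply: contraNneq h => ->; exact: vge0.
Qed.

Fact residue_inv0 : residue_inv 0 = 0.
Proof. by rewrite /residue_inv eqxx. Qed.

HB.instance Definition _ :=
  GRing.ComNzRing_isField.Build residue_field residue_mulVf residue_inv0.

End ResidueField.

(** * Reduction of integral polynomials *)

Section ResiduePoly.
Variables (K : fieldType) (v : K -> int) (hv : valuation v).
Local Notation res := (residue hv).

Lemma residue0 : res 0 = 0.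
Proof. by apply/eqP; rewrite residue_eq0 vge0. Qed.

Lemma residue_sum I r (P : pred I) (E : I -> K) : (forall i, P i -> vge v 0 (E i)) ->
  res (\sum_(i <- r | P i) E i) = \sum_(i <- r | P i) res (E i).
Proof.
move=> h; suff [] : res (\sum_(i <- r | P i) E i) = \sum_(i <- r | P i) res (E i)
  /\ vge v 0 (\sum_(i <- r | P i) E i) by [].
elim/big_ind2: _ => [|x y z t [<- hx] [<- hz]|i Pi]; first by rewrite residue0 vge0.
  by rewrite residueD ?(vgeD hv).
by split; last exact: h.
Qed.

Lemma residueN x : vge v 0 x -> res (- x) = - res x.
Proof.
move=> hx; apply/eqP; rewrite -addr_eq0 -residueD ?vgeN // addNr residue0 //.
Qed.

Lemma residueB x y : vge v 0 x -> vge v 0 y -> res (x - y) = res x - res y.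
Proof. by move=> hx hy; rewrite residueD ?vgeN // residueN. Qed.

Lemma residue_eq x y : vge v 0 x -> vge v 0 y -> (res x == res y) = vge v 1 (x - y).
Proof. by move=> hx hy; rewrite -subr_eq0 -residueB // residue_eq0 // vgeB. Qed.

Lemma residueX x n : vge v 0 x -> res (x ^+ n) = res x ^+ n.
Proof.
move=> hx; elim: n => [|n IH]; first by rewrite !expr0 residue1.
by rewrite !exprS residueM ?IH // vgeX.
Qed.

Lemma residue_nat n : res n%:R = n%:R.
Proof.
elim: n => [|n IH]; first exact: residue0.
by rewrite -addn1 !natrD residueD ?vge_nat ?vge1 // IH residue1.
Qed.

Definition redp (q : {poly K}) := map_poly res q.
Definition integralp (q : {poly K}) := forall i, vge v 0 q`_i.

Lemma coef_redp q i : (redp q)`_i = res q`_i.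
Proof. by rewrite coef_map_id0 // residue0. Qed.

Lemma redpD q r : integralp q -> integralp r -> redp (q + r) = redp q + redp r.
Proof. by move=> hq hr; apply/polyP => i; rewrite coefD !coef_redp coefD residueD. Qed.

Lemma redpM q r : integralp q -> integralp r -> redp (q * r) = redp q * redp r.
Proof.
move=> hq hr; apply/polyP => i; rewrite coefM !coef_redp coefM residue_sum; last first.
  by move=> j _; rewrite (vgeMl hv).
by apply: eq_bigr => j _; rewrite residueM // !coef_redp.
Qed.

Lemma integralpM q r : integralp q -> integralp r -> integralp (q * r).
Proof. by move=> hq hr i; rewrite coefM vge_sum // => j _; rewrite (vgeMl hv). Qed.

Lemma integralpD q r : integralp q -> integralp r -> integralp (q + r).
Proof. by move=> hq hr i; rewrite coefD vgeD. Qed.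

Lemma integralpC c : vge v 0 c -> integralp c%:P.
Proof. by move=> hc i; rewrite coefC; case: ifP => // _; exact: vge0. Qed.

Lemma integralpX : integralp 'X.
Proof. by move=> i; rewrite coefX; case: eqP => _; [exact: (vge1 hv) | exact: vge0]. Qed.

Lemma redpC c : redp c%:P = (res c)%:P.
Proof. by apply/polyP => i; rewrite coef_redp !coefC; case: ifP => // _; exact: residue0. Qed.

Lemma integralp_deriv q : integralp q -> integralp q^`().
Proof. by move=> hq i; rewrite coef_deriv -mulr_natr (vgeMr hv) // vge_nat. Qed.

Lemma redp_deriv q : integralp q -> redp q^`() = (redp q)^`().
Proof.
move=> hq; apply/polyP => i; rewrite coef_redp !coef_deriv coef_redp.
by rewrite -mulr_natr residueM ?vge_nat // residue_nat mulr_natr.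
Qed.

Lemma redp_eq0 q : integralp q -> (redp q == 0) <-> (forall i, vge v 1 q`_i).
Proof.
move=> hq; split => [/eqP h i|h]; first by rewrite -residue_eq0 // -coef_redp h coef0.
by apply/eqP/polyP => i; rewrite coef0 coef_redp; apply/eqP; rewrite residue_eq0.
Qed.

Lemma vge_horner q x : integralp q -> vge v 0 x -> vge v 0 q.[x].
Proof.
by move=> hq hx; rewrite horner_coef vge_sum // => i _; rewrite (vgeMl hv) ?vgeX.
Qed.

Lemma size_redp q : (size (redp q) <= size q)%N.
Proof. exact: size_poly. Qed.

Lemma redp_horner q x : integralp q -> vge v 0 x -> (redp q).[res x] = res q.[x].
Proof.
move=> hq hx; rewrite (horner_coef_wide _ (size_redp q)) horner_coef residue_sum.
  by apply: eq_bigr => i _; rewrite coef_redp residueM ?vgeX // residueX.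
by move=> i _; rewrite (vgeMl hv) ?vgeX.
Qed.

Lemma vge_horner_sub N q x y : integralp q -> vge v 0 x -> vge v 0 y ->
  vge v N (x - y) -> vge v N (q.[x] - q.[y]).
Proof.
move=> hq hx hy h; rewrite !horner_coef -sumrB vge_sum // => i _.
by rewrite -mulrBr (vgeMl hv) // vge_subXX.
Qed.

(** A nonzero reduction of [q] would have more distinct roots, the residues of [ys], than its
    degree. *)
Lemma integralp_roots q (ys : seq K) : integralp q -> all (vge v 0) ys ->
  uniq [seq res y | y <- ys] -> (size q <= size ys)%N ->
  (forall y, y \in ys -> vge v 1 q.[y]) -> forall i, vge v 1 q`_i.
Proof.
move=> hq hys uys sq h; apply/redp_eq0 => //; apply: contraLR sq => q0; rewrite -ltnNge.
apply: leq_trans (size_redp q); rewrite -(size_map res ys); apply: max_poly_roots => //.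
apply/allP => _ /mapP[y yys ->]; have hy := allP hys y yys.
by rewrite /root redp_horner // residue_eq0 ?vge_horner ?h.
Qed.

End ResiduePoly.

(* Over [k'], the gcd of [q] and ['X^(p ^ t.+1) - c] is associate to [('X - a) ^+ r];
   its constant term shows that [a ^+ r] comes from [k], hence so does
   [a ^+ gcdn r (p ^ t.+1)], which rules out [0 < r < p ^ t.+1]. *)
Lemma purely_insep_degree (k k' : fieldType) (f : {rmorphism k -> k'}) p t (a : k') c q :
  prime p -> f c = a ^+ (p ^ t.+1) -> (forall d, f d != a ^+ (p ^ t)) ->
  p \in [pchar k'] -> q != 0 -> root (map_poly f q) a -> (p ^ t.+1 < size q)%N.
Proof.
move=> pr hc hd chp q0 rq; rewrite ltnNge; apply/negP => sq.
have p0 : (0 < p)%N by exact: prime_gt0.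
have a0 : a != 0.
  apply: contraNneq (hd 0) => ->; by rewrite rmorph0 expr0n; have := expn_gt0 p t; rewrite p0 /=; case: (p ^ t)%N.
set N := (p ^ t.+1)%N in hc sq.
have N0 : (0 < N)%N by rewrite expn_gt0 p0.
pose h := 'X^N - c%:P.
have fh : map_poly f h = ('X - a%:P) ^+ N.
  rewrite rmorphB /= map_polyXn map_polyC /= hc.
  have chN : [pchar {poly k'}]%R.-nat N.
    by rewrite (eq_pnat _ (pchar_poly _)) pnatX pnatE ?chp.
  by rewrite exprDn_pchar // exprNn_pchar // polyC_exp.
pose g := gcdp q h.
have g0 : g != 0 by rewrite gcdp_eq0 negb_and q0.
have fg : map_poly f g %| ('X - a%:P) ^+ N by rewrite -fh dvdp_map dvdp_gcdr.
have ra : root (map_poly f g) a.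
  by rewrite gcdp_map root_gcd rq fh /root horner_exp hornerXsubC subrr expr0n gtn_eqF /=.
case/dvdp_exp_XsubCP: fg => r rN Dg.
have sg : (size g <= N)%N by apply: leq_trans sq; rewrite dvdp_leq // dvdp_gcdl.
have rs : size g = r.+1 by rewrite -(size_map_poly f) (eqp_size Dg) size_exp_XsubC.
have r0 : (0 < r)%N.
  case: (posnP r) Dg => // ->; rewrite expr0 => /eqp_root/(_ a).
  by rewrite ra rootE hornerC oner_eq0.
have [e he] : exists e, f e = a ^+ r.
  case/eqpP: Dg => -[c1 c2] /= /andP[c10 c20] Dg.
  have lg : lead_coef g != 0 by rewrite lead_coef_eq0.
  have h1 : c1 * f (lead_coef g) = c2.
    have := congr1 lead_coef Dg; rewrite !lead_coefZ lead_coef_map.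
    by rewrite (monicP (monic_exp _ (monicXsubC a))) mulr1.
  have h2 : c1 * f g.[0] = c2 * (- a) ^+ r.
    have := congr1 (horner^~ 0) Dg; rewrite !hornerZ horner_exp hornerXsubC sub0r.
    by rewrite -[0 in LHS](rmorph0 f) horner_map.
  exists ((-1) ^+ r * (g.[0] / lead_coef g)).
  rewrite rmorphM rmorph_sign fmorph_div; apply: (canLR (signrMK r)).
  rewrite -exprNn; apply: (canLR (mulfK _)); first by rewrite fmorph_eq0.
  by apply: (mulfI c10); rewrite h2 -h1; ring.
have [u ut Du] : exists2 u, (u <= t)%N & gcdn r N = (p ^ u)%N.
  have /(dvdn_pfactor _ _ pr) [u _ Du] := dvdn_gcdr r N; exists u => //.
  rewrite -ltnS -(ltn_exp2l _ _ (prime_gt1 pr)) -Du.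
  by apply: leq_ltn_trans (dvdn_leq r0 (dvdn_gcdl r N)) _; rewrite -rs.
(* Bezout gives [km * r = kn * N + p ^ u], so [e ^+ km / c ^+ kn] maps to [a ^+ (p ^ u)]; as
   [u <= t], a further power reaches [a ^+ (p ^ t)]. *)
case: (egcdnP N r0) => km kn Dk _.
have := hd ((e ^+ km / c ^+ kn) ^+ (p ^ (t - u))); case/eqP.
rewrite rmorphXn fmorph_div !rmorphXn /= he hc -!exprM mulnC Dk exprD Du [(_ * N)%N]mulnC.
by rewrite mulrAC divff ?mul1r ?expf_neq0 // -exprM -expnD subnKC.
Qed.

(** * Residue fields of intermediate fields and independent residues *)

Section Subfields.
Variables (F : fieldType) (L : fieldExtType F) (v : L -> int) (hv : valuation v).
Implicit Types E : {subfield L}.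
Local Notation res := (residue hv).

Lemma inOE (U : {vspace L}) x : inO v U x = (x \in U) && vge v 0 x.
Proof. by []. Qed.

Lemma inME (U : {vspace L}) x : inM v U x = (x \in U) && vge v 1 x.
Proof. by []. Qed.

Lemma inOP (U : {vspace L}) x : inO v U x -> x \in U /\ vge v 0 x.
Proof. by case/andP. Qed.

Lemma polyO_integralp (U : {vspace L}) q : polyO v U q -> integralp v q.
Proof. by move=> hq i; case/andP: (hq i). Qed.

Lemma polyO_horner E q x : polyO v E q -> inO v E x -> inO v E q.[x].
Proof.
move=> hq /inOP[xE hx]; rewrite inOE (vge_horner hv) ?andbT //; last exact: polyO_integralp hq.
by rewrite rpred_horner //; apply/polyOverP => i; case/andP: (hq i).
Qed.

Lemma polyOS (E E' : {vspace L}) q : (E <= E')%VS -> polyO v E q -> polyO v E' q.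
Proof. by move=> sE hq i; case/inOP: (hq i) => h1 h2; rewrite inOE h2 (subvP sE). Qed.

(** The field is the residue field of the valuation restricted to [subvs_of E]. Having it as a field
    in its own right lets gcd arguments on polynomials run over it. *)
Lemma residue_subfield E : exists (k : fieldType) (iota : {rmorphism k -> residue_field hv}),
  (forall z, exists2 c, inO v E c & iota z = res c) /\
  (forall c, inO v E c -> exists z, iota z = res c).
Proof.
pose w (x : subvs_of E) := v (vsval x).
have w0 (x : subvs_of E) : (vsval x == 0) = (x == 0) by rewrite -(inj_eq val_inj) /=.
have hw : valuation w.
  split=> x y x0 y0; rewrite /w /=; first by apply: hv.1; rewrite w0.
  by move=> xy0; apply: hv.2; rewrite ?w0.
have wge N x : vge w N x = vge v N (vsval x) by rewrite /vge w0.
pose f z := res (vsval (residue_repr (hv := hw) z)).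
have fE x : vge w 0 x -> f (residue hw x) = res (vsval x).
  move=> hx; apply/eqP; rewrite residue_eq -?wge ?vge0_residue_repr //.
  rewrite -(raddfB (vsval : subvs_of E -> L)) -wge -(residue_eq hw) ?vge0_residue_repr //.
  by rewrite residue_reprK.
have fB : zmod_morphism f.
  move=> x y; have hx := vge0_residue_repr x; have hy := vge0_residue_repr y.
  rewrite -[in LHS](residue_reprK x) -[in LHS](residue_reprK y) -residueB //.
  by rewrite fE ?(vgeB hw) // raddfB residueB -?wge.
have fM : monoid_morphism f.
  split; first by rewrite -(residue1 hw) fE ?(vge1 hw) // [vsval 1]rmorph1 residue1.
  move=> x y; have hx := vge0_residue_repr x; have hy := vge0_residue_repr y.
  rewrite -[in LHS](residue_reprK x) -[in LHS](residue_reprK y) -residueM //.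
  by rewrite fE ?(vgeMl hw) // [vsval _]rmorphM residueM -?wge.
pose fa := GRing.isZmodMorphism.Build _ _ f fB.
pose fm := GRing.isMonoidMorphism.Build _ _ f fM.
pose fr : {rmorphism residue_field hw -> residue_field hv} := HB.pack f fa fm.
exists (residue_field hw), fr; split.
  move=> z; exists (vsval (residue_repr z)) => //.
  by rewrite inOE subvsP -wge vge0_residue_repr.
move=> c /inOP[cE hc]; have hc' : vge w 0 (vsproj E c) by rewrite wge vsprojK.
by exists (residue hw (vsproj E c)); rewrite /= fE ?vsprojK.
Qed.

(* The residues of [1, y, ..., y ^+ n.-1] are linearly independent over the residue
   field of [E]. *)
Definition res_indep E y n := forall q : {poly L}, polyO v E q -> (size q <= n)%N ->
  vge v 1 q.[y] -> forall i, vge v 1 q`_i.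

Lemma res_indep1 E y : res_indep E y 1.
Proof.
move=> q hq sq; rewrite (size1_polyC sq) hornerC => h i; rewrite coefC.
by case: ifP => // _; exact: vge0.
Qed.

(** A dependence would reduce to a nonzero polynomial over the residue field of [E] vanishing at the
    residue of [y], too small in degree for [purely_insep_degree]. *)
Lemma res_indep_purely_insep E y p t : prime p -> vge v 1 (p%:R : L) -> vge v 0 y ->
  (exists2 c, inO v E c & vge v 1 (y ^+ (p ^ t.+1) - c)) ->
  (forall c, inO v E c -> ~~ vge v 1 (y ^+ (p ^ t) - c)) -> res_indep E y (p ^ t.+1).
Proof.
move=> pr hp hy [c cE hc] hn q hq sq hqy.
have [k [f [fO Of]]] := residue_subfield E.
apply/(redp_eq0 hv) => //; first exact: polyO_integralp hq.
have [b Db] := Of c cE; have [_ c0] := inOP cE.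
have chp : p \in [pchar residue_field hv].
  by rewrite inE pr -(residue_nat hv) residue_eq0 ?vge_nat.
have [g Dg] : exists g, redp hv q = map_poly f g.
  have /functional_choice [g hg] : forall i, exists z, f z = res q`_i.
    by move=> i; apply: Of (hq i).
  exists (\poly_(i < size q) g i); apply/polyP => i.
  rewrite coef_redp coef_map coef_poly; case: ltnP => [_|h]; first by rewrite /= hg.
  by rewrite nth_default // residue0 /= rmorph0.
have ra : root (map_poly f g) (res y).
  by rewrite -Dg /root redp_horner ?residue_eq0 ?vge_horner //; exact: polyO_integralp hq.
rewrite Dg map_poly_eq0; apply/negPn/negP => g0.
have : (p ^ t.+1 < size g)%N.
  apply: (purely_insep_degree (c := b) pr _ _ chp g0 ra).
    apply/eqP; rewrite Db -residueX // residue_eq ?vgeX //.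
    by rewrite (vgeBC hv).
  move=> d; have [e eE ->] := fO d; have [_ e0] := inOP eE.
  by rewrite -residueX // residue_eq ?vgeX // (vgeBC hv) hn.
rewrite ltnNge -(size_map_poly f) -Dg; apply/negP/negPn.
exact: leq_trans (size_redp _ _) sq.
Qed.

(** Residue-independent elements are independent over [E]: dividing a relation by its coefficient of
    least valuation makes it integral with one coefficient equal to 1, which cannot reduce to a
    trivial relation. *)
Lemma res_free_size E E' s : (E <= E')%VS -> res_free v E E' s ->
  (size s <= \dim_E E')%N.
Proof.
move=> sEE' [sE' fs]; set n := size s.
have ind (a : 'I_n -> L) : (forall i, a i \in E) -> \sum_i a i * s`_i = 0 -> forall i, a i = 0.
  move=> aE a0 i; apply/eqP/negPn/negP => ai0.
  have [j aj0 jmin] : exists2 j, a j != 0 & forall i, a i != 0 -> v (a j) <= v (a i).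
    by case: (@Order.TotalTheory.arg_minP _ _ _ i (fun i => a i != 0) (fun i => v (a i)) ai0) => j; exists j.
  have := fs [seq a i / a j | i <- enum 'I_n].
  rewrite size_map size_enum_ord => /(_ erefl).
  have -> : all (inO v E) [seq a i / a j | i <- enum 'I_n].
    apply/allP => _ /mapP[l _ ->]; rewrite inOE rpred_div // /vge mulf_eq0 invr_eq0 (negPf aj0) orbF.
    by have [//|al0] := eqVneq (a l) 0; rewrite hv.1 ?invr_eq0 // (valuationV hv) // subr_ge0 jmin.
  have nthE l : [seq a i / a j | i <- enum 'I_n]`_(nat_of_ord l) = a l / a j.
    by rewrite (nth_map l) ?size_enum_ord // nth_ord_enum.
  have -> : \sum_(l < n) [seq a i / a j | i <- enum 'I_n]`_l * s`_l = 0.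
    under eq_bigr => l _ do rewrite nthE mulrAC.
    by rewrite -mulr_suml a0 mul0r.
  rewrite inME rpred0 vge0 => /(_ isT isT)/allP/(_ (a j / a j)).
  rewrite divff // inME /vge (valuation1 hv) oner_eq0 /= andbF => h.
  by apply: notF; apply: h; apply/mapP; exists j; rewrite ?mem_enum // divff.
have sn0 (i : 'I_n) : s`_i != 0.
  apply/eqP => si0; have := ind (fun j => (j == i)%:R) _ _ i; rewrite eqxx => h.
  have /eqP : (1 : L) = 0; last by rewrite oner_eq0.
  apply: h => [j|]; first by case: eqP => _; rewrite ?rpred0 ?rpred1.
  rewrite big1 // => j _; case: (j =P i) => [->|_]; last by rewrite mul0r.
  by rewrite si0 mulr0.
have dir : directv (\sum_(i < n) (E * <[s`_i]>)%VS).
  apply/directv_sum_independent => u uE u0 i _.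
  have /functional_choice [a ha] : forall i, exists a, a \in E /\ u i = a * s`_i.
    by move=> j; have /memv_cosetP[a aE ->] := uE j isT; exists a.
  rewrite (ha i).2 (ind a) ?mul0r // => [j|]; first exact: (ha j).1.
  by apply: etrans u0; apply: eq_bigr => j _; rewrite (ha j).2.
rewrite leq_divRL ?adim_gt0 //.
have -> : (n * \dim E)%N = \dim (\sum_(i < n) (E * <[s`_i]>)%VS).
  rewrite (directvP dir) /= (eq_bigr (fun=> \dim E)) ?sum_nat_const ?card_ord // => i _.
  by rewrite dim_cosetv.
apply: dimvS; apply/subv_sumP => i _; apply/prodvP => a b aE /vlineP[c ->].
rewrite -scalerAr rpredZ // rpredM ?(subvP sEE' _ aE) //.
by case/inOP: (allP sE' _ (mem_nth 0 (ltn_ord i))).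
Qed.

End Subfields.

(** * Residue degrees and expansions in powers of one element *)

Section ResidueDegree.
Variables (F : fieldType) (L : fieldExtType F) (v : L -> int) (hv : valuation v).
Implicit Types E : {subfield L}.

Let powers (y : L) m := [seq y ^+ i | i <- iota 0 m].

Fact powers_nth y m i : (i < m)%N -> (powers y m)`_i = y ^+ i.
Proof. by move=> im; rewrite (nth_map 0%N) ?size_iota // nth_iota. Qed.

Fact powers_sum y m (a : seq L) : (size a <= m)%N ->
  \sum_(i < m) a`_i * (powers y m)`_i = (Poly a).[y].
Proof.
move=> sa; rewrite (@horner_coef_wide _ m) ?(leq_trans (size_Poly a)) //.
by apply: eq_bigr => i _; rewrite coef_Poly powers_nth.
Qed.

Fact polyO_Poly E (a : seq L) : all (inO v E) a -> polyO v E (Poly a).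
Proof.
move=> ha i; rewrite coef_Poly; have [ia|ia] := ltnP i (size a).
  by rewrite (allP ha) // mem_nth.
by rewrite nth_default // inOE rpred0 vge0.
Qed.

Fact powers_inO E y m : inO v E y -> all (inO v E) (powers y m).
Proof.
case/inOP=> yE hy; apply/allP => _ /mapP[i _ ->].
by rewrite inOE rpredX // vgeX.
Qed.

Lemma res_indep_degree E E' y : (E <= E')%VS -> inO v E' y ->
  res_indep v E y (\dim_E E') -> res_degree v E E' (\dim_E E').
Proof.
move=> sE yE hi; split; last by move=> s; exact: (res_free_size hv).
exists (powers y (\dim_E E')); rewrite size_map size_iota; split=> //.
split=> [|a]; rewrite ?powers_inO // size_map size_iota => sa ha.
rewrite powers_sum ?sa // inME => /andP[_ hs]; apply/allP => x xa.
rewrite inME; case/inOP: (allP ha x xa) => -> _ /=.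
have := hi _ (polyO_Poly ha) _ hs (index x a).
by rewrite coef_Poly nth_index //; apply; rewrite -sa size_Poly.
Qed.

(** By [res_free_size], adding [x] to the maximal family of powers of [y] creates a residue
    relation; the coefficient of [x] in it is a unit, so the relation can be solved for [x]. *)
Lemma res_indep_approx E E' y x : (E <= E')%VS -> inO v E' y ->
  res_indep v E y (\dim_E E') -> inO v E' x ->
  exists q, [/\ polyO v E q, (size q <= \dim_E E')%N & vge v 1 (x - q.[y])].
Proof.
set m := \dim_E E' => sE yE hi xE.
have /not_and_or[|] : ~ res_free v E E' (rcons (powers y m) x).
  by move/(res_free_size hv sE); rewrite size_rcons size_map size_iota ltnn.
  by rewrite all_rcons xE powers_inO.
move=> hn; have [a ha0] := not_all_ex_not _ _ hn.
have [sa ha1] := imply_to_and _ _ ha0; have [ha hs1] := imply_to_and _ _ ha1.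
have {ha0 ha1 hs1} [hs hna] := imply_to_and _ _ hs1; move: sa hs hna; rewrite size_rcons size_map size_iota.
case/lastP: a ha => // a b ha; move: ha; rewrite size_rcons all_rcons => /andP[bE ha] [sa].
rewrite big_ord_recr /= nth_rcons sa ltnn eqxx nth_rcons size_map size_iota ltnn eqxx.
have -> : \sum_(i < m) (rcons a b)`_i * (rcons (powers y m) x)`_i = (Poly a).[y].
  rewrite -(@powers_sum y m) ?sa //; apply: eq_bigr => i _.
  by rewrite !nth_rcons size_map size_iota sa ltn_ord.
rewrite inME => /andP[_ hs]; rewrite all_rcons inME; have [-> /= hb] := inOP bE.
(* If [b] were not a unit, the term [b * x] would drop out and the independence of the powers would
   kill all the other coefficients. *)
have [b1|b1 _] := boolP (vge v 1 b).
  case=> /=; apply/allP => z za; rewrite inME; case/inOP: (allP ha z za) => -> _ /=.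
  have := hi _ (polyO_Poly ha) _ _ (index z a); rewrite coef_Poly nth_index //; apply.
    by rewrite -sa size_Poly.
  by rewrite -(addrK (b * x) (Poly a).[y]) vgeB // (vgeMr hv) //; case/inOP: xE.
have b0 : b != 0 by apply: contraNneq b1 => ->; exact: vge0.
have hbV := vge_inv hv hb b1.
exists ((- b^-1) *: Poly a); split.
- move=> i; rewrite coefZ inOE; have [h1 h2] := inOP (polyO_Poly ha i).
  by have [bE' _] := inOP bE; rewrite rpredM ?rpredN ?rpredV // (vgeMl hv) ?vgeN.
- by apply: leq_trans (size_scale_leq _ _) _; rewrite -sa size_Poly.
- rewrite hornerZ mulNr opprK; have -> : x + b^-1 * (Poly a).[y] = b^-1 * ((Poly a).[y] + b * x).
    by rewrite mulrDr mulKf // addrC.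
  exact: (vgeMl hv).
Qed.

(** Each [y ^+ i] is replaced by [c ^+ (i %/ n) * y ^+ (i %% n)], that is, [q] is reduced modulo
    ['X^n - c]; the error is an integral multiple of [y ^+ n - c]. *)
Lemma horner_reduce E y n c N q : (0 < n)%N -> vge v 0 y -> inO v E c ->
  vge v N (y ^+ n - c) -> polyO v E q ->
  exists r, [/\ polyO v E r, (size r <= n)%N & vge v N (q.[y] - r.[y])].
Proof.
move=> n0 hy cE h hq; have [cE' hc] := inOP cE.
exists (\sum_(i < size q) (q`_i * c ^+ (i %/ n)) *: 'X^(i %% n)); split.
- move=> j; rewrite coef_sum inOE rpred_sum ?vge_sum // => i _; have [h1 h2] := inOP (hq i).
    by rewrite coefZ coefXn (vgeMl hv) ?vge_nat // (vgeMl hv) ?vgeX.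
  by rewrite coefZ coefXn rpredM ?rpredM ?rpredX //; case: (j == _); rewrite ?rpred1 ?rpred0.
- apply/leq_sizeP => j nj; rewrite coef_sum big1 // => i _.
  by rewrite coefZ coefXn gtn_eqF ?mulr0 // (leq_trans _ nj) // ltn_mod.
- rewrite horner_coef horner_sum -sumrB vge_sum // => i _; have [h1 h2] := inOP (hq i).
  rewrite hornerZ hornerXn -mulrA -mulrBr (vgeMl hv) //.
  rewrite {1}(divn_eq i n) exprD [(_ %/ n * n)%N]mulnC exprM -mulrBl (vgeMr hv) ?vgeX //.
  by rewrite vge_subXX ?vgeX.
Qed.

(* If [y] generates the residue field of [L] and [y ^+ n] has its residue in that
   of [E], then [k_E] is already the residue field of any [E'] over which the
   residues of [1, ..., y ^+ n.-1] are independent. *)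
Lemma res_indep_descent (K : {vspace L}) E E' y n c x : (K <= E)%VS -> (E <= E')%VS -> (0 < n)%N ->
  vge v 0 y -> inO v E c -> vge v 1 (y ^+ n - c) -> res_indep v E' y n ->
  (exists2 q, polyO v K q & x = q.[y]) -> inO v E' x ->
  exists2 d, inO v E d & vge v 1 (x - d).
Proof.
move=> sK sE n0 hy cE h hi [q hq Dx] xE'.
have [r [hr sr hqr]] := horner_reduce n0 hy cE h (polyOS sK hq).
exists r`_0 => //; rewrite (vgeBC hv).
(* [x] is itself a coefficient in [E'], so independence over [E'] applies to [r - x%:P], and its
   constant coefficient gives the congruence. *)
have := hi (r - x%:P) _ _ _ 0; rewrite coefB coefC /=; apply.
- move=> i; rewrite coefB coefC inOE; have [h1 h2] := inOP (polyOS sE hr i).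
  have [h3 h4] := inOP xE'.
  by case: ifP => _; rewrite ?subr0 ?h1 // rpredB ?vgeB.
- by apply: leq_trans (size_polyD _ _) _; rewrite geq_max sr size_polyN (leq_trans (size_polyC_leq1 _)).
- by rewrite hornerD hornerN hornerC (vgeBC hv) Dx.
Qed.

End ResidueDegree.

(** * Coordinates over the complete base field *)

Section Complete.
Variables (F : fieldType) (L : fieldExtType F) (v : L -> int) (hv : valuation v).
Hypothesis cplt : complete_sub v (1%AS : {subfield L}).

Lemma base_limit (u : nat -> F) :
  (forall N : int, exists n0, forall m n, (n0 <= m)%N -> (n0 <= n)%N ->
     vge v N (u m - u n)%:A) ->
  exists l : F, forall N : int, exists n0, forall n, (n0 <= n)%N -> vge v N (u n - l)%:A.
Proof.
move=> hu; have [n|N|l /vlineP[l' ->] hl] := @cplt (fun n => (u n)%:A).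
- exact: rpredZ (rpred1 _).
- by have [n0 h] := hu N; exists n0 => m n hm hn; rewrite -scalerBl; apply: h.
by exists l' => N; have [n0 h] := hl N; exists n0 => n hn; rewrite scalerBl; apply: h.
Qed.

(* By induction the span of [s] is complete, hence closed, so [x] stays at a positive
   distance from it. *)
Lemma coords_bounded (s : seq L) : free s -> exists C : int, forall (c : nat -> F) N,
  vge v N (\sum_(i < size s) c i *: s`_i) -> forall i, (i < size s)%N -> vge v (N - C) (c i)%:A.
Proof.
elim: s => [_|x s IH]; first by exists 0.
rewrite free_cons => /andP[xs fs]; have [C hC] := IH fs.
have x0 : x != 0 by apply: contraNneq xs => ->; exact: rpred0.
(* If there were no such [N0], combinations of [s] would approach [-x]; their coordinates would be
   Cauchy by the induction hypothesis, and the limits would put [x] in the span. *)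
have [N0 hN0] : exists N0, forall c : nat -> F, ~~ vge v N0 (x + \sum_(i < size s) c i *: s`_i).
  apply: NNPP => hn; have /functional_choice[c hc] :
      forall n : nat, exists c : nat -> F, vge v n%:Z (x + \sum_(i < size s) c i *: s`_i).
    move=> n; apply: NNPP => hn1; apply: hn; exists n%:Z => c; apply/negP => h.
    by apply: hn1; exists c.
  have cauchy i : (i < size s)%N -> forall N : int, exists n0, forall m n, (n0 <= m)%N -> (n0 <= n)%N ->
     vge v N (c m i - c n i)%:A.
    move=> si N; exists (absz (N + C)) => m n hm hn1.
    have := hC (fun i => c m i - c n i) (N + C) _ i si; rewrite addrK; apply.
    have -> : \sum_(i < size s) (c m i - c n i) *: s`_i =
      (x + \sum_(i < size s) c m i *: s`_i) - (x + \sum_(i < size s) c n i *: s`_i).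
      rewrite opprD addrACA subrr add0r -sumrB.
      by apply: eq_bigr => j _; rewrite scalerBl.
    by rewrite (vgeB hv) //; apply: vgeW (hc _); lia.
  have /functional_choice[l hl] : forall i, exists l : F, (i < size s)%N ->
      forall N : int, exists n0, forall n, (n0 <= n)%N -> vge v N (c n i - l)%:A.
    move=> i; have [si|si] := boolP (i < size s)%N; last by exists 0.
    by have [l hl] := base_limit (cauchy i si); exists l.
  move/negP: xs; apply; rewrite -[x](addrK (\sum_(i < size s) l i *: s`_i)).
  rewrite [x + _](@vge_eq0 _ v) ?sub0r ?rpredN ?rpred_sum // => [i _|N].
    by rewrite rpredZ // memv_span // mem_nth.
  have {}hl i : (i < size s)%N -> exists n0, forall n, (n0 <= n)%N ->
      vge v N ((c n i - l i) *: s`_i).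
    move=> si; have [s0|s0] := eqVneq s`_i 0.
      by exists 0%N => n _; rewrite s0 scaler0 vge0.
    have [n0 h] := hl i si (N%:Z - v s`_i); exists n0 => n hn1.
    rewrite -[s`_i]mul1r scalerAl -[N%:Z](subrK (v s`_i)).
    by apply: (vgeM hv); [exact: h | rewrite /vge lexx orbT].
  have [n0 h0] : exists n0, forall i n, (i < size s)%N -> (n0 <= n)%N ->
      vge v N ((c n i - l i) *: s`_i).
    elim: (size s) hl => [|k IHk] hl; first by exists 0%N.
    have [i ik|n1 h1] := IHk; first by apply: hl; rewrite ltnS ltnW.
    have [n2 h2] := hl k (ltnSn k); exists (maxn n1 n2) => i n.
    rewrite ltnS leq_eqVlt geq_max => /orP[/eqP->|ik] /andP[hn1 hn2]; first exact: h2.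
    exact: h1.
  pose n := maxn n0 N.
  have -> : x + \sum_(i < size s) l i *: s`_i = (x + \sum_(i < size s) c n i *: s`_i)
     - \sum_(i < size s) (c n i - l i) *: s`_i.
    rewrite -addrA -sumrB; congr (_ + _); apply: eq_bigr => i _.
    by rewrite scalerBl opprB addrC subrK.
  rewrite (vgeB hv) //; first by apply: vgeW (hc n); rewrite lez_nat leq_maxr.
  by rewrite (vge_sum hv) // => i _; rewrite h0 // leq_maxl.
have [d d0 d1] : exists2 d : int, 0 <= d & N0 - v x <= d.
  by exists (Num.max 0 (N0 - v x)); rewrite le_max lexx ?orbT.
(* The first coordinate loses [N0]. The others lose [d] when the term in [x] is removed, and then
   [C] by induction. *)
have [D DN0 DC] : exists2 D : int, N0 <= D & C + d <= D.
  by exists (Num.max N0 (C + d)); rewrite le_max lexx ?orbT.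
exists D => c N.
rewrite big_ord_recl /=; set S := \sum_(i < _) _ => hS.
have h0 : vge v (N - N0) (c 0%N)%:A.
  have [->|c0] := eqVneq (c 0%N) 0; first by rewrite scale0r vge0.
  have c0A : (c 0%N)%:A != 0 :> L by rewrite scaler_eq0 oner_eq0 orbF.
  rewrite /vge (negPf c0A) /= leNgt; apply/negP => hc.
  (* Dividing the sum by [c 0] turns it into [x] plus a combination of [s]; too small a valuation of
     [c 0] would bring this beyond the bound [N0]. *)
  have /negP := hN0 (fun i => (c 0%N)^-1 * c i.+1); apply.
  have -> : x + \sum_(i < size s) ((c 0%N)^-1 * c i.+1) *: s`_i = (c 0%N *: x + S) / (c 0%N)%:A.
    apply: (canRL (mulfK c0A)); rewrite mulrDl; congr (_ + _); first by rewrite -scalerAr mulr1.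
    rewrite mulr_suml; apply: eq_bigr => i _.
    by rewrite -scalerAl -scalerAr mulr1 scalerA mulrAC mulVf // mul1r.
  by apply: vgeW (vge_div hv c0A hS); rewrite lerBrDr addrC -lerBrDr ltW.
case=> [_|i] /=; first by apply: vgeW h0; lia.
rewrite ltnS => si; have hS' : vge v (N - d) S.
  rewrite -[S](addrK (c 0%N *: x)) [S + _]addrC (vgeB hv) //; first by apply: vgeW hS; lia.
  rewrite -[x]mul1r scalerAl; apply: (@vgeW _ _ _ (N - N0 + v x)).
    by rewrite -addrA lerD2l lerNl opprD opprK.
  by apply: (vgeM hv) => //; rewrite /vge lexx orbT.
by apply: vgeW (hC (fun i => c i.+1) _ hS' i si); lia.
Qed.

End Complete.

(** * Galois invariance of the valuation *)

Section GaloisInvariance.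
Variables (F : fieldType) (L : splittingFieldType F) (v : L -> int) (hv : valuation v).
Hypothesis cplt : complete_sub v (1%AS : {subfield L}).

(** By linearity and [coords_bounded], [s] lowers valuations by at most a constant. Applied to all
    powers of [x], this forces the loss to be zero; the inverse of [s] gives the other
    inequality. *)
Lemma vge_gal (s : gal_of {:L}) N x : vge v N (s x) = vge v N x.
Proof.
suff {s N x} val_gal (s : gal_of {:L}) x : x != 0 -> v x <= v (s x).
  have [->|x0] := eqVneq x 0; first by rewrite rmorph0.
  have h1 := val_gal s x x0; have sx0 : s x != 0 by rewrite fmorph_eq0.
  have := val_gal s^-1%g (s x) sx0; rewrite -galM ?memvf // mulgV gal_id => h2.
  by rewrite /vge (negPf x0) (negPf sx0) (@le_anti _ _ (v x) (v (s x))) ?h1.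
move=> x0; set b := vbasis {:L}.
have [C hC] := coords_bounded hv cplt (basis_free (vbasisP {:L})).
have [V hV] : exists V, forall i : 'I_(\dim {:L}), vge v V (s b`_i).
  exists (\big[Num.min/0]_(i < \dim {:L}) v (s b`_i)) => i.
  by rewrite /vge bigmin_le_cond // orbT.
have bound y N : vge v N y -> vge v (N - C + V) (s y).
  move=> hy; pose c (i : nat) := if insub i is Some j then coord b j y else 0.
  have Dy : y = \sum_(i < \dim {:L}) c i *: b`_i.
    rewrite {1}(coord_vbasis (memvf y)); apply: eq_bigr => i _.
    by rewrite /c insubT /= ?ltn_ord // => hi; congr (coord b _ y *: _); apply: val_inj.
  rewrite Dy in hy *; rewrite linear_sum (vge_sum hv) // => i _ /=.
  have -> : s (c i *: b`_i) = (c i)%:A * s b`_i by rewrite linearZ /= -scalerAl mul1r.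
  apply: (vgeM hv) => //.
  by apply: (hC c N); rewrite size_tuple.
have {}bound n : (v x *+ n) - C + V <= v (s x) *+ n.
  have := bound (x ^+ n) (v x *+ n); rewrite rmorphXn /vge !expf_eq0 fmorph_eq0 (negPf x0) !andbF /=.
  by rewrite !(valuationX hv) ?fmorph_eq0 //; apply.
rewrite leNgt; apply/negP => h.
(* A loss of at least 1 on [x] becomes a loss of at least [n] on [x ^+ n], and this [n] exceeds the
   permitted [C - V]. *)
have := bound (absz (C - V)).+1; set n := (absz _).+1.
have : (1 *+ n : int) <= (v x - v (s x)) *+ n by rewrite lerMn2r -gtz0_ge1 subr_gt0 h orbT.
by rewrite mulrnBl /n; move: (v x *+ _) (v (s x) *+ _); lia.
Qed.

End GaloisInvariance.

(** * The inertia group and its unramified fixed field *)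

Lemma vge_prod_sub (K : fieldType) (v : K -> int) (hv : valuation v) (I : finType)
  (A : {pred I}) (f : I -> K) a : vge v 0 a -> (forall i, i \in A -> vge v 1 (f i - a)) ->
  vge v 0 (\prod_(i in A) f i) /\ vge v 1 (\prod_(i in A) f i - a ^+ #|A|).
Proof.
move=> ha h; rewrite -prodr_const.
suff [h1 _ h2] : [/\ vge v 0 (\prod_(i in A) f i), vge v 0 (\prod_(i in A) a)
  & vge v 1 (\prod_(i in A) f i - \prod_(i in A) a)] by [].
elim/big_ind2: _ => [|x y z t [hx hy hxy] [hz ht hzt]|i iA].
- by rewrite subrr vge0 (vge1 hv).
- split; rewrite ?(vgeMl hv) //.
  apply: (vge_trans hv (y := y * z)); first by rewrite -mulrBr (vgeMl hv).
  by rewrite -mulrBl (vgeMr hv).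
- split; rewrite ?h // -(subrK a (f i)) vgeD // (@vgeW _ _ 0 1) ?h //.
Qed.

Lemma residue_transversal (K : fieldType) (v : K -> int) (hv : valuation v) (l : seq K) :
  exists l', [/\ {subset l' <= l}, uniq (map (residue hv) l')
    & map (residue hv) l' =i map (residue hv) l].
Proof.
elim: l => [|a l [l' [sl ul el]]]; first by exists [::].
have [al|al] := boolP (residue hv a \in map (residue hv) l').
  exists l'; split=> // [x xl|z]; first by rewrite inE sl ?orbT.
  by rewrite /= inE -el; case: eqP => // ->; rewrite al.
exists (a :: l'); split=> [x||z]; rewrite /= ?al // !inE ?el //.
by case/orP=> [->//|/sl->]; rewrite orbT.
Qed.

Section GaloisResidue.
Variables (F : fieldType) (L : splittingFieldType F) (v : L -> int) (hv : valuation v).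
Hypothesis cplt : complete_sub v (1%AS : {subfield L}).
Variables (p : nat) (alpha : L).
Hypotheses (pr : prime p) (hp : vge v 1 (p%:R : L)).
Hypotheses (alphaO : vge v 0 alpha)
  (alphaP : forall x, vge v 0 x -> exists2 q, polyO v (1%AS : {subfield L}) q & x = q.[alpha]).
Local Notation res := (residue hv).
Implicit Types (s t : gal_of {:L}) (E : {subfield L}).

Lemma gal_horner E s (q : {poly L}) x : s \in 'Gal({:L} / E)%g -> polyO v E q ->
  s q.[x] = q.[s x].
Proof.
move=> sE hq; rewrite -horner_map (fixedPoly_gal (subvf E)) //.
by apply/polyOverP => i; case/inOP: (hq i).
Qed.

Lemma gal_base s : s \in 'Gal({:L} / 1)%g.
Proof.
rewrite gal_kHom ?subvf //; apply/kAHomP => _ /vlineP[c ->].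
by rewrite linearZ /= rmorph1.
Qed.

(** Since [alpha] generates the valuation ring over the base, [s x - x] is an integral multiple of
    [s alpha - alpha]. *)
Lemma vge_gal_sub N s x : vge v 0 x -> vge v N (s alpha - alpha) -> vge v N (s x - x).
Proof.
move=> /alphaP[q hq ->] h; rewrite (gal_horner _ (gal_base s) hq).
by apply: (vge_horner_sub hv); rewrite ?(vge_gal hv cplt) //; exact: polyO_integralp hq.
Qed.

(** All [#|H|] factors of the norm are congruent to [alpha]. This is the source of elements of a
    fixed field whose residue is a known power of that of [alpha]. *)
Lemma norm_approx (H : {group gal_of {:L}}) : (forall s, s \in H -> vge v 1 (s alpha - alpha)) ->
  let b := galNorm (fixedField H) {:L} alpha in
  inO v (fixedField H) b /\ vge v 1 (b - alpha ^+ #|H|).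
Proof.
move=> hH b; have bE : b \in fixedField H.
  by have := galNorm_fixedField (fixedField H) (memvf alpha); rewrite gal_fixedField.
rewrite inOE bE /= /b /galNorm gal_fixedField.
exact: (vge_prod_sub hv).
Qed.

(** Testing on [alpha] suffices: by [vge_gal_sub] these automorphisms act trivially on the whole
    residue field. *)
Definition inertia := [set s : gal_of {:L} | vge v 1 (s alpha - alpha)].

Fact inertia_group_set : group_set inertia.
Proof.
apply/group_setP; split=> [|s t]; first by rewrite inE gal_id subrr vge0.
rewrite !inE galM ?memvf // => hs ht.
by apply: (vge_trans hv (y := t alpha)) => //; rewrite -rmorphB (vge_gal hv cplt).
Qed.
Canonical inertia_group := Group inertia_group_set.

Lemma inertia_normal : (inertia_group <| 'Gal({:L} / 1))%g.
Proof.
apply/andP; split; first by apply/subsetP => s _; exact: gal_base.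
apply/subsetP => t _; rewrite inE; apply/subsetP => _ /imsetP[s hs ->].
move: hs; rewrite !inE conjgE !galM ?memvf // => hs.
set y := t^-1%g alpha; have <- : t y = alpha by rewrite -galM ?memvf // mulVg gal_id.
by rewrite -rmorphB (vge_gal hv cplt) vge_gal_sub // (vge_gal hv cplt).
Qed.

Hypothesis pG : (p.-group 'Gal({:L} / 1))%g.
Hypothesis galL : galois (1%AS : {subfield L}) {:L}.

Let E := fixedField_aspace inertia.
Let beta := galNorm (fixedField inertia) {:L} alpha.
Let m := \dim_(1%AS : {subfield L}) E.

Fact inertia_norm : inO v E beta /\ vge v 1 (beta - alpha ^+ #|inertia|).
Proof. by apply: (@norm_approx inertia_group) => s; rewrite inE. Qed.

Fact pchar_residue : p \in [pchar residue_field hv].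
Proof. by rewrite inE pr -(residue_nat hv) residue_eq0 ?vge_nat. Qed.

(** The residue of [beta] is the [n]-th power of that of [alpha], with [n] a power of [p], and
    raising to such a power is injective on the residue field. *)
Fact conj_beta s t : vge v 1 (s beta - t beta) -> vge v 1 (s alpha - t alpha).
Proof.
have [_ hb] := inertia_norm; set n := #|inertia| in hb => h.
have hn (u : gal_of {:L}) : vge v 1 (u beta - u alpha ^+ n).
  have -> : u alpha ^+ n = u (alpha ^+ n) by rewrite rmorphXn.
  by rewrite -rmorphB (vge_gal hv cplt).
have a0 (u : gal_of {:L}) : vge v 0 (u alpha) by rewrite (vge_gal hv cplt).
have chn : [pchar (residue_field hv)].-nat n.
  have : p.-nat n by apply: (pgroupS _ pG); have /andP[] := inertia_normal.
  by apply: sub_in_pnat => q _; rewrite inE => /eqP ->; exact: pchar_residue.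
rewrite -(residue_eq hv) // -subr_eq0.
suff: (res (s alpha) - res (t alpha)) ^+ n == 0 by rewrite expf_eq0 => /andP[].
have -> : (res (s alpha) - res (t alpha)) ^+ n = res (s alpha ^+ n - t alpha ^+ n).
  by rewrite exprDn_pchar // exprNn_pchar // residueB ?vgeX // !residueX.
rewrite residue_eq0; last by rewrite (vgeB hv) ?vgeX.
apply: (vge_trans hv (y := s beta)); first by rewrite (vgeBC hv).
exact: (vge_trans hv h).
Qed.

(** One conjugate of [beta] is taken per right coset of the inertia group. By [conj_beta], equal
    residues force equal cosets. *)
Fact inertia_roots : exists ys : seq L, [/\ size ys = m, all (vge v 0) ys,
  uniq (map res ys) & forall y, y \in ys -> exists s, y = s beta].
Proof.
exists [seq (repr A) beta | A : {set gal_of {:L}} <- enum (rcosets inertia 'Gal({:L} / 1)%g)].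
have b0 : vge v 0 beta by have [/inOP[]] := inertia_norm.
split.
- rewrite size_map -cardE -[#|_|]/(#|'Gal({:L} / 1) : inertia|%g) /m.
  by rewrite (@dim_fixed_galois _ _ _ _ inertia_group galL) //; have /andP[] := inertia_normal.
- by apply/allP => _ /mapP[A _ ->]; rewrite (vge_gal hv cplt).
- rewrite -map_comp map_inj_in_uniq ?enum_uniq // => A B; rewrite !mem_enum /=.
  move=> /rcosetsP[a _ ->] /rcosetsP[b _ ->] /eqP.
  rewrite residue_eq ?(vge_gal hv cplt) // => /conj_beta.
  have [x xI] := repr_rcosetP inertia_group a; have [y yI] := repr_rcosetP inertia_group b.
  rewrite !galM ?memvf // => h; apply/(rcoset_eqP (G := inertia_group)).
  rewrite mem_rcoset inE galM ?memvf //.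
  rewrite -(vge_gal hv cplt b) rmorphB /=.
    have -> : b (b^-1%g (a alpha)) = a alpha by rewrite -galM ?memvf // mulVg gal_id.
  move: xI yI; rewrite !inE => xI yI.
  apply: (vge_trans hv (y := a (x alpha))).
    by rewrite (vgeBC hv) -rmorphB (vge_gal hv cplt).
  by apply: (vge_trans hv h); rewrite -rmorphB (vge_gal hv cplt).
- by move=> _ /mapP[A _ ->]; exists (repr A).
Qed.

(** The coefficients of [q] are Galois-fixed, so [q] vanishes in the residue field at all [m]
    conjugates of [beta], which are too many roots for its size. *)
Fact inertia_res_indep : res_indep v (1%AS : {subfield L}) beta m.
Proof.
have [ys [sys yO uys yb]] := inertia_roots.
move=> q hq sq h; apply: (integralp_roots (polyO_integralp hq) yO uys); rewrite ?sys //.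
move=> _ /yb[s ->].
by rewrite -(gal_horner _ (gal_base s) hq) (vge_gal hv cplt).
Qed.

(** Writing [c] as [q.[beta]] modulo the maximal ideal, invariance makes all [m] residues of
    conjugates of [beta] roots of [q - c%:P]; its reduction is zero, so [c] is congruent to the
    constant coefficient of [q]. *)
Fact inertia_invariant c : inO v E c -> (forall s, vge v 1 (s c - c)) ->
  exists2 d, inO v (1%AS : {subfield L}) d & vge v 1 (c - d).
Proof.
move=> cE hc; have [ys [sys yO uys yb]] := inertia_roots.
have [bE _] := inertia_norm; have [_ c0] := inOP cE.
have [q [hq sq hcq]] := res_indep_approx hv (sub1v _) bE inertia_res_indep cE.
exists q`_0 => //; rewrite (vgeBC hv).
have {1}-> : q`_0 - c = (q - c%:P)`_0 by rewrite coefB coefC.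
apply: (@integralp_roots _ _ hv _ ys _ yO uys).
- move=> i; rewrite coefB coefC (vgeB hv) //; first exact: polyO_integralp hq i.
  by case: ifP => // _; exact: vge0.
- rewrite sys; apply: leq_trans (size_polyD _ _) _; rewrite geq_max sq size_polyN.
  by rewrite (leq_trans (size_polyC_leq1 _)) // divn_gt0 ?adim_gt0 // dimvS ?sub1v.
- move=> _ /yb[s ->]; rewrite hornerD hornerN hornerC -(gal_horner _ (gal_base s) hq).
  apply: (vge_trans hv (y := s c)) => //.
  by rewrite -rmorphB (vge_gal hv cplt) (vgeBC hv).
Qed.

Lemma redp_lift (k : fieldType) (f : {rmorphism k -> residue_field hv}) (U : {subfield L}) u :
  (forall z, exists2 c, inO v U c & f z = res c) ->
  exists2 g, polyO v U g & redp hv g = map_poly f u.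
Proof.
move=> fO; have /functional_choice[g hg] : forall i, exists c, inO v U c /\ f u`_i = res c.
  by move=> i; have [c cU fc] := fO u`_i; exists c.
exists (\poly_(i < size u) g i).
  move=> i; rewrite coef_poly; case: ifP => _; first exact: (hg i).1.
  by rewrite inOE rpred0 vge0.
apply/polyP => i; rewrite coef_redp coef_map coef_poly; case: ltnP => [_|h] /=.
  by rewrite -(hg i).2.
by rewrite residue0 nth_default // rmorph0.
Qed.

(** The product of the linear factors at the distinct residues of conjugates of [x] is separable and
    Galois-invariant; [inertia_invariant] moves its coefficients to the base. *)
Fact inertia_separable : res_separable v (1%AS : {subfield L}) E.
Proof.
move=> x xE; have [xE1 x0] := inOP xE.
have [cs [scs ucs ecs]] := residue_transversal hv [seq (s : gal_of {:L}) x | s <- enum (setT : {set gal_of {:L}})].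
(* [E] is Galois-stable because the inertia group is normal. *)
have galE s : s x \in E.
  have [_ cx] := mem_fixedFieldP xE1; apply/fixedFieldP; rewrite ?memvf // => t tI.
  rewrite -galM ?memvf // conjgCV galM ?memvf // cx // memJ_norm // groupV.
  exact: subsetP (normal_norm inertia_normal) _ (gal_base s).
have csE c : c \in cs -> inO v E c.
  by move/scs/mapP=> [s _ ->]; rewrite inOE galE (vge_gal hv cplt).
set f := \prod_(c <- cs) ('X - c%:P).
have fE : polyO v E f.
  have : f \is a polyOver E.
    rewrite /f big_seq rpred_prod // => c /csE/inOP[cE _].
    by rewrite rpredB ?polyOverX // polyOverC.
  move=> /polyOverP fE i; rewrite inOE fE /=; move: i.
  suff : integralp v f by [].
  rewrite /f big_seq; elim/big_ind: _ => [|g h|c /csE/inOP[_ c0]].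
  - by rewrite -polyC1; apply: (integralpC (vge1 hv)).
  - exact: (integralpM hv).
  - by move=> i; rewrite coefB (vgeB hv) ?integralpC // integralpX.
have redX c : vge v 0 c -> redp hv ('X - c%:P) = 'X - (res c)%:P.
  move=> c0; apply/polyP => i; rewrite coef_redp !coefB !coefX !coefC.
  by case: (i =P 0%N) => _; rewrite residueB ?(vge_nat hv) ?residue_nat ?residue0 ?vge0.
have red_prod (l : seq L) : all (vge v 0) l ->
    redp hv (\prod_(c <- l) ('X - c%:P)) = \prod_(c <- map res l) ('X - c%:P)
    /\ integralp v (\prod_(c <- l) ('X - c%:P)).
  elim: l => [_|c l IH /= /andP[c0 /IH[IH1 IH2]]].
    by rewrite !big_nil -polyC1 redpC residue1; split=> //; apply: (integralpC (vge1 hv)).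
  have ic : integralp v ('X - c%:P).
    by move=> i; rewrite coefB (vgeB hv) ?integralpC // (integralpX hv).
  by rewrite !big_cons redpM // IH1 redX //; split=> //; exact: (integralpM hv).
have cs0 : all (vge v 0) cs by apply/allP => c /csE/inOP[].
have [redf _] := red_prod cs cs0.
have finv i s : vge v 1 (s f`_i - f`_i).
  have [_ fi0] := inOP (fE i).
  rewrite -(residue_eq hv) ?(vge_gal hv cplt) //.
  rewrite -(coef_redp hv f) -coef_map -(coef_redp hv) redf; apply/eqP; congr (_`_i).
  rewrite rmorph_prod /=; under eq_bigr do rewrite rmorphB /= map_polyX map_polyC /=.
  rewrite -(big_map (fun c => s c) xpredT (fun c => 'X - c%:P)).
  have [|-> _] := red_prod [seq s c | c <- cs].
    by apply/allP => _ /mapP[c cc ->]; rewrite (vge_gal hv cplt) (allP cs0).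
  (* [s] permutes the residues of all conjugates of [x], and [cs] represents each of these once. *)
  suff pe : perm_eq (map res [seq s c | c <- cs]) (map res cs) by rewrite (perm_big _ pe).
  have sub : {subset map res cs <= map res [seq s c | c <- cs]}.
    move=> _ /mapP[c cc ->]; have [t _ Dc] := mapP (scs c cc).
    have Dt : (t * s^-1)%g x = s^-1%g c by rewrite galM ?memvf // -Dc.
    have /mapP[c' cc' /eqP Dc'] : res (s^-1%g c) \in map res cs.
      by rewrite -Dt ecs; apply: map_f; apply/mapP; exists (t * s^-1)%g; rewrite ?mem_enum ?in_setT.
    apply/mapP; exists (s c'); first exact: map_f.
    have [c0 c'0] := (allP cs0 _ cc, allP cs0 _ cc').
    apply/eqP; rewrite residue_eq ?(vge_gal hv cplt) //.
    have <- : s (s^-1%g c) = c by rewrite -galM ?memvf // mulVg gal_id.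
    by rewrite -rmorphB (vge_gal hv cplt) -(residue_eq hv) // (vge_gal hv cplt).
  have sz : (size (map res [seq s c | c <- cs]) <= size (map res cs))%N by rewrite !size_map.
  rewrite perm_sym; apply: uniq_perm => //; first exact: leq_size_uniq sub sz.
  by have [] := uniq_min_size ucs sub sz.
have /functional_choice[d hd] : forall i, exists d, inO v (1%AS : {subfield L}) d /\ vge v 1 (f`_i - d).
  by move=> i; have [d] := inertia_invariant (fE i) (finv i); exists d.
(* The top coefficient is set to exactly 1, since [d n] is only congruent to it. *)
pose n := size cs; pose h := \poly_(i < n) d i + 'X^n.
have hO : polyO v (1%AS : {subfield L}) h.
  move=> i; rewrite coefD coef_poly coefXn; have [h1 h2] := inOP (hd i).1.
  by case: (i < n)%N; rewrite inOE ?add0r ?rpredD ?(vgeD hv) ?(vge_nat hv) ?rpred_nat.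
have sf : size f = n.+1 by rewrite size_prod_XsubC.
have redh : redp hv h = redp hv f.
  apply/polyP => i; rewrite !coef_redp coefD coef_poly coefXn.
  have [h1 h2] := hd i; have [_ h3] := inOP h1; have [_ h4] := inOP (fE i).
  case: (ltngtP i n) => hi /=; rewrite ?addr0 ?add0r.
  - by apply/eqP; rewrite residue_eq // (vgeBC hv).
  - by rewrite nth_default // sf.
  - congr res; have /monicP := monic_prod_XsubC cs xpredT id.
    by rewrite -/f /lead_coef sf hi.
exists h; split=> //.
- rewrite monicE /h addrC lead_coefDl ?lead_coefXn // size_polyXn ltnS.
  exact: size_poly.
- rewrite inME; have [-> _] := inOP (polyO_horner hv (polyOS (sub1v _) hO) xE).
  rewrite -(residue_eq0 hv) ?(vge_horner hv) //; last exact: polyO_integralp hO.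
  rewrite -redp_horner //; last exact: polyO_integralp hO.
  rewrite redh redf -/(root _ _) root_prod_XsubC ecs.
  by apply/mapP; exists x => //; apply/mapP; exists 1%g; rewrite ?gal_id ?mem_enum ?in_setT.
have [k [iota [fO Of]]] := residue_subfield hv (1%AS : {subfield L}).
have [h0 Dh] : exists h0, redp hv h = map_poly iota h0.
  have /functional_choice[g hg] : forall i, exists z, iota z = res h`_i.
    by move=> i; apply: Of (hO i).
  exists (\poly_(i < size h) g i); apply/polyP => i.
  rewrite coef_redp coef_map coef_poly; case: ltnP => [_|hi]; first by rewrite /= hg.
  by rewrite nth_default // residue0 /= rmorph0.
(* Coprimality is checked after extension to the residue field of [L], where the roots are visible;
   the Bezout coefficients then exist over the residue field of the base and are lifted. *)
have : coprimep h0 h0^`().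
  rewrite -(coprimep_map iota) -deriv_map -Dh redh redf.
  have := separable_prod_XsubC (map res cs); rewrite ucs; by rewrite separable_poly.unlock.
case/Bezout_eq1_coprimepP => -[u w] /= huw.
have [g gO Dg] := redp_lift u fO; have [g' gO' Dg'] := redp_lift w fO.
exists g, g'; split=> // i.
have [ig ig'] := (polyO_integralp gO, polyO_integralp gO').
have [ih ih'] := (polyO_integralp hO, integralp_deriv hv (polyO_integralp hO)).
have i1 : integralp v (-1 : {poly L}).
  by move=> j; rewrite coefN coef1 (vgeN hv) (vge_nat hv).
rewrite inME; apply/andP; split.
  have over (q : {poly L}) : polyO v (1%AS : {subfield L}) q -> q \is a polyOver 1%AS.
    by move=> hq; apply/polyOverP => j; case/inOP: (hq j).
  have h2 := over _ hO; have h3 : h^`() \is a polyOver 1%AS by exact: polyOver_deriv h2.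
  move: i; apply/polyOverP; rewrite rpredB ?rpred1 // rpredD // rpredM //; exact: over.
move: i; apply/(redp_eq0 hv).
  by apply: integralpD => //; apply: (integralpD hv); apply: (integralpM hv).
rewrite redpD ?redpD ?redpM //; try by [apply: (integralpM hv) | apply: (integralpD hv); apply: (integralpM hv)].
rewrite redp_deriv // Dh Dg Dg' deriv_map -!rmorphM -rmorphD huw rmorph1.
by rewrite -polyC1 -polyCN redpC residueN ?(vge1 hv) // residue1 polyCN subrr.
Qed.

Lemma inertia_unramified : unramified v (1%AS : {subfield L}) E.
Proof.
split; last exact: inertia_separable.
by apply: (res_indep_degree hv (sub1v _) _ inertia_res_indep); have [] := inertia_norm.
Qed.

End GaloisResidue.

(** * Residue degrees over fixed fields containing [K0] *)

Section Ferocious.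
Variables (F : fieldType) (L : splittingFieldType F) (v : L -> int) (hv : valuation v).
Hypothesis cplt : complete_sub v (1%AS : {subfield L}).
Variables (p : nat) (alpha : L) (K0 : {subfield L}).
Hypotheses (pr : prime p) (hp : vge v 1 (p%:R : L)).
Hypotheses (alphaO : vge v 0 alpha)
  (alphaP : forall x, vge v 0 x -> exists2 q, polyO v (1%AS : {subfield L}) q & x = q.[alpha]).
Hypothesis unif : exists2 x : L, vge v 1 x & ~~ vge v 2 x.
Hypothesis trivial_res : forall s, s \in 'Gal({:L} / K0)%g -> vge v 1 (s alpha - alpha).
Variable t : nat.
Hypothesis residue_root : exists2 c, inO v K0 c & vge v 1 (alpha ^+ (p ^ t) - c).
Hypothesis residue_min : forall u c, (u < t)%N -> inO v K0 c -> ~~ vge v 1 (alpha ^+ (p ^ u) - c).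

Lemma base_indep : res_indep v K0 alpha (p ^ t).
Proof.
case: t residue_root residue_min => [_ _|u hr hm]; first exact: res_indep1.
by apply: (res_indep_purely_insep hv pr hp alphaO hr) => c; apply: hm.
Qed.

(* If no element of [K0] is a uniformizer, elements of [K0] of positive valuation
   have valuation at least 2, and so would every [q.[alpha]] of positive valuation
   if [alpha ^+ (p ^ t) - B] did: reduce [q] modulo ['X^(p ^ t) - B]. *)
Lemma root_uniformizer B : inO v K0 B -> (forall z, inM v K0 z -> vge v 2 z) ->
  vge v 1 (alpha ^+ (p ^ t) - B) -> ~~ vge v 2 (alpha ^+ (p ^ t) - B).
Proof.
move=> BO nunif hB; apply/negP => h; have [x x1 /negP] := unif; apply.
have x0 : vge v 0 x by apply: vgeW x1.
have [q hq Dx] := alphaP x0.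
have n0 : (0 < p ^ t)%N by rewrite expn_gt0 prime_gt0.
have [r [hr sr hqr]] := horner_reduce hv n0 alphaO BO h (polyOS (sub1v K0) hq).
rewrite -Dx in hqr; rewrite -(subrK r.[alpha] x) (vgeD hv) //.
have r1 : vge v 1 r.[alpha].
  by rewrite -[r.[alpha]](subKr x) (vgeB hv) //; apply: vgeW hqr.
have hr1 := base_indep hr sr r1.
rewrite horner_coef (vge_sum hv) // => i _; rewrite (vgeMr hv) ?vgeX //.
by apply: nunif; rewrite inME hr1 andbT; case/inOP: (hr i).
Qed.

(* Induction on [N]: [x = d + pi * x'] with [d] fixed by [s] gives
   [s x - x = (s pi - pi) * s x' + pi * (s x' - x')]. *)
Lemma gal_sub_uniformizer (E E' : {subfield L}) (s : gal_of {:L}) pi :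
  s \in 'Gal({:L} / E)%g -> (E <= E')%VS -> pi \in E' -> vge v 1 pi -> ~~ vge v 2 pi ->
  (forall x, inO v E' x -> exists2 d, inO v E d & vge v 1 (x - d)) ->
  forall (N : nat) x, vge v N%:Z (s pi - pi) -> inO v E' x -> vge v N%:Z (s x - x).
Proof.
move=> sE sEE' piE pi1 pi2 hE; elim=> [|N IH] x hpi xE.
  by have [_ x0] := inOP xE; rewrite (vgeB hv) ?(vge_gal hv cplt).
have [xE' x0] := inOP xE; have [d /inOP[dE d0] hd] := hE x xE.
have pi0 : pi != 0 by apply: contraNneq pi2 => ->; exact: vge0.
have vpi : v pi = 1 by move: pi1 pi2; rewrite /vge (negPf pi0) /=; lia.
pose x' := (x - d) / pi.
have x'O : inO v E' x'.
  have dE' := subvP sEE' _ dE.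
  by rewrite inOE rpred_div ?rpredB //; have := vge_div hv pi0 hd; rewrite vpi subrr.
have Dx : x = d + pi * x' by rewrite /x' mulrC divfK // addrC subrK.
have -> : s x - x = (s pi - pi) * s x' + pi * (s x' - x').
  by rewrite {1 2}Dx rmorphD rmorphM /= (fixed_gal (subvf E) sE dE); ring.
have [_ x'0] := inOP x'O.
apply: (vgeD hv); first by rewrite (vgeMr hv) ?(vge_gal hv cplt).
rewrite intS; apply: (vgeM hv) => //.
by apply: IH x'O; apply: vgeW hpi; rewrite lez_nat.
Qed.

(** Through [res_indep_degree] this gives residue degree [#|H|]. The norm over [H] has the residue
    of [alpha ^+ #|H|], so only an earlier [p]-power of [alpha] with residue coming from the fixed
    field must be excluded. *)
Lemma subgroup_indep j (H : {group gal_of {:L}}) : H \subset 'Gal({:L} / K0)%g ->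
  #|H| = (p ^ j)%N -> (j <= t)%N -> res_indep v (fixedField H) alpha (p ^ j).
Proof.
elim: j H => [|j IH] H sH cH jt; first exact: res_indep1.
have pH : (p.-group H)%g by rewrite /pgroup cH pnatX pnat_id.
have [|H1 [sH1 _ cH1]] := normal_pgroup (r := j) pH (normal_refl H).
  by rewrite cH pfactorK.
have sH1' := subset_trans sH1 sH.
have ind1 := IH H1 sH1' cH1 (ltnW jt).
pose M := fixedField_aspace H1; pose M' := fixedField_aspace H.
have sMM' : (M' <= M)%VS by apply: fixedFieldS.
have sK0 (A : {group gal_of {:L}}) : A \subset 'Gal({:L} / K0)%g -> (K0 <= fixedField A)%VS.
  by rewrite galois_connection ?subvf.
have [bO hb] := norm_approx hv alphaO (fun s sA => trivial_res (subsetP sH s sA)).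
apply: (res_indep_purely_insep (E := M') hv pr hp alphaO).
  by exists (galNorm (fixedField H) {:L} alpha) => //; rewrite (vgeBC hv) -cH.
move=> c cO; apply/negP => hc.
have n0 : (0 < p ^ j)%N by rewrite expn_gt0 prime_gt0.
(* Such a [c] would make [M] and [M'] have the same residue field. *)
have desc x : inO v M x -> exists2 d, inO v M' d & vge v 1 (x - d).
  move=> xO; apply: (res_indep_descent hv (sub1v _) sMM' n0 alphaO cO hc ind1) => //.
  by apply: alphaP; case/inOP: xO.
have [s sH' sH1n] : exists2 s, s \in H & s \notin H1.
  apply/subsetPn; apply/negP => sHH1; have := subset_leq_card sHH1.
  by rewrite cH cH1 leqNgt ltn_exp2l ?prime_gt1 // ltnSn.
have sM' : s \in 'Gal({:L} / M')%g by rewrite gal_fixedField.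
have [yO hy] := norm_approx hv alphaO (fun s sA => trivial_res (subsetP sH1' s sA)).
set y := galNorm _ _ _ in yO hy; have [yM y0] := inOP yO.
have [pi [piM pi1 pi2 hpi]] : exists pi, [/\ pi \in M, vge v 1 pi, ~~ vge v 2 pi
    & forall N : nat, (0 < N)%N -> vge v N%:Z (s y - y) -> vge v N.+1%:Z (s pi - pi)].
  have [[z zM z2]|nz] := classic (exists2 z, inM v K0 z & ~~ vge v 2 z).
    case/andP: zM => zK z1; exists z; split=> //; first exact: subvP (sK0 _ sH1') _ zK.
    move=> N _ _; rewrite (fixed_gal (subvf _) sM') ?subrr ?vge0 //.
    exact: subvP (sK0 _ sH) _ zK.
  have nunif z : inM v K0 z -> vge v 2 z.
    by move=> zM; apply/negPn/negP => z2; apply: nz; exists z.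
  have [B BO hB] := residue_root; have [BK B0] := inOP BO.
  have hB2 := root_uniformizer BO nunif hB.
  have Dt : (p ^ t)%N = (p ^ j * p ^ (t - j))%N by rewrite -expnD subnKC // ltnW.
  (* As [j < t], at least one [p]-th power is taken, so the congruence between [y] and
     [alpha ^+ (p ^ j)] improves to valuation 2 and [y ^+ (p ^ (t - j)) - B] remains a
     uniformizer. *)
  have hyt : vge v 2 (y ^+ (p ^ (t - j)) - alpha ^+ (p ^ t)).
    rewrite Dt exprM; apply: (vge_subXpn (N := 1) hv hp); rewrite ?vgeX ?subn_gt0 //.
    by rewrite -cH1.
  exists (y ^+ (p ^ (t - j)) - B); split.
  - by rewrite rpredB ?rpredX // (subvP (sK0 _ sH1')).
  - by apply: (vge_trans hv _ hB); apply: vgeW hyt.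
  - apply: contra hB2 => h; apply: (vge_trans hv (y := y ^+ (p ^ (t - j)))) => //.
    by rewrite (vgeBC hv).
  move=> N N0 hN; rewrite rmorphB rmorphXn /= (fixed_gal (subvf _) sM' (subvP (sK0 _ sH) _ BK)).
  rewrite opprB addrA subrK.
  rewrite intS [1 + _]addrC; apply: (vge_subXpn hv hp) => //; last by rewrite subn_gt0.
  by rewrite (vge_gal hv cplt).
have hsub := gal_sub_uniformizer sM' sMM' piM pi1 pi2 desc.
(* Each round transfers the bound from [pi] to [y] by [hsub] and returns it to [pi] one unit better
   by [hpi]. *)
have hpiN (N : nat) : vge v N.+1%:Z (s pi - pi).
  elim: N => [|N IHN]; last by apply: hpi => //; apply: hsub.
  apply: (vge_gal_sub hv cplt alphaO alphaP); first exact: vgeW pi1.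
  by apply: trivial_res; apply: subsetP sH s sH'.
have fixO x : inO v M x -> s x = x.
  move=> xO; apply/eqP; rewrite -subr_eq0; apply/eqP; apply: (@vge_eq0 _ v) => N.
  by apply: hsub => //; apply: vgeW (hpiN N); rewrite lez_nat.
case/negP: sH1n; suff: s \in 'Gal({:L} / fixedField H1)%g by rewrite gal_fixedField.
rewrite gal_kHom ?subvf //; apply/kAHomP => x xM.
(* Any element of [M] or its inverse is integral, so [s] fixes the whole field and lies in [H1]. *)
have /orP[x0|x0] := vge_or_inv hv x; first by apply: fixO; rewrite inOE xM.
by apply: invr_inj; rewrite -fmorphV /= fixO // inOE rpredV xM.
Qed.

End Ferocious.

(** * Choice of the exponent and construction of the intermediate field *)

Lemma least_nat (P : nat -> Prop) n : P n -> exists m, [/\ (m <= n)%N, P m & forall u, (u < m)%N -> ~ P u].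
Proof.
elim/ltn_ind: n => n IH Pn.
have [[u [un Pu]]|h] := classic (exists u, (u < n)%N /\ P u).
  by have [m [mu Pm hm]] := IH u un Pu; exists m; split=> //; apply: leq_trans mu (ltnW un).
by exists n; split=> // u un Pu; apply: h; exists u.
Qed.

Theorem theorem2 (F : fieldType) (L : splittingFieldType F) (v : L -> int)
  (p : nat) (K0 : {subfield L}) :
  is_dvaluation v ->
  (exists2 a, a \in (1%AS : {subfield L}) & a != 0 /\ v a != 0) ->
  complete_sub v (1%AS : {subfield L}) ->
  prime p -> inM v fullv (p%:R : L) ->
  res_pdeg_finite v p (1%AS : {subfield L}) ->
  galois (1%AS : {subfield L}) fullv ->
  (p.-group 'Gal(fullv / (1%AS : {subfield L})))%g ->
  well_ramified v (1%AS : {subfield L}) fullv ->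
  (* K0 = L ∩ K_ur, the maximal unramified subextension of L/K *)
  (unramified v (1%AS : {subfield L}) K0 /\
   forall E : {subfield L}, unramified v (1%AS : {subfield L}) E -> (E <= K0)%VS) ->
  exists T : {subfield L},
    [/\ (K0 <= T)%VS, galois K0 T, caseI v K0 T & caseII v p T fullv].
Proof.
case=> vM vD [u0 [u00 vu0]] _ cplt pr /andP[_ hp] _ galL pG.
case=> alpha [/inOP[_ alphaO] [_ hal]] [_ maxK0].
have hv : valuation v by split.
have alphaP x : vge v 0 x -> exists2 q, polyO v (1%AS : {subfield L}) q & x = q.[alpha].
  by move=> x0; have [q [h1 h2]] := hal x (introT andP (conj (memvf x) x0)); exists q.
have unif : exists2 x : L, vge v 1 x & ~~ vge v 2 x.
  by exists u0; rewrite /vge (negPf u00) vu0.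
have galK0 : galois K0 fullv by apply: galoisS galL; rewrite sub1v subvf.
(* Maximality of [K0] puts the inertia field inside it, so automorphisms over [K0] lie in the
   inertia group. *)
have sEK0 := maxK0 _ (inertia_unramified hv cplt pr hp alphaO alphaP pG galL).
have triv s : s \in 'Gal({:L} / K0)%g -> vge v 1 (s alpha - alpha).
  move/(subsetP (galS _ sEK0)).
  by rewrite (gal_fixedField (inertia_group hv cplt alpha)) inE.
pose G0 := ('Gal({:L} / K0))%G.
have pG0 : (p.-group G0)%g by apply: pgroupS pG; apply: galS; exact: sub1v.
have [g cG0] := p_natP pG0.
have [bO hb] := norm_approx hv alphaO triv.
(* The norm from [L] to [K0] shows that the exponent [g] works; the least one satisfies [t <= g], so
   a normal subgroup of order [p ^ t] exists. *)
have Pg : exists2 c, inO v K0 c & vge v 1 (alpha ^+ (p ^ g) - c).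
  have Dfix : fixedField ('Gal({:L} / K0))%g = K0 by apply/galois_fixedField.
  exists (galNorm (fixedField G0) {:L} alpha); first by rewrite -Dfix.
  by rewrite (vgeBC hv) -cG0.
have [t [tg ht hmin]] := least_nat (P := fun g => exists2 c, inO v K0 c & vge v 1 (alpha ^+ (p ^ g) - c)) Pg.
have {}hmin u c : (u < t)%N -> inO v K0 c -> ~~ vge v 1 (alpha ^+ (p ^ u) - c).
  by move=> ut cO; apply/negP => h; apply: hmin ut _; exists c.
have [|H [_ nH cH]] := normal_pgroup (r := t) pG0 (normal_refl G0).
  by rewrite cG0 pfactorK.
have sH := normal_sub nH.
have ind := subgroup_indep hv cplt pr hp alphaO alphaP unif triv ht hmin sH cH (leqnn t).
have sK0 : (K0 <= fixedField H)%VS by rewrite -galois_connection ?subvf.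
have [cO hc] := norm_approx hv alphaO (fun s sA => triv s (subsetP sH s sA)).
exists (fixedField_aspace H); split=> //.
- by apply: (normal_fixedField_galois galK0); exact: nH.
- move=> x xO; have [c0 c0O hc0] := ht.
  have n0 : (0 < p ^ t)%N by rewrite expn_gt0 prime_gt0.
  (* The fixed field of [H] has the same residue field as [K0], so each residue is a root of a
     linear polynomial over [K0]. *)
  have [d dO hd] : exists2 d, inO v K0 d & vge v 1 (x - d).
    apply: (res_indep_descent hv (sub1v _) sK0 n0 alphaO c0O hc0 ind) => //.
    by apply: alphaP; case/inOP: xO.
  have [dK d0] := inOP dO; have [xT _] := inOP xO.
  have polyO1 : polyO v K0 1%:P.
    by move=> i; rewrite inOE coefC; case: eqP => _; rewrite ?rpred1 ?rpred0 ?(vge1 hv) ?vge0.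
  exists ('X - d%:P); split.
  + move=> i; rewrite coefB coefX coefC inOE rpredB ?(vgeB hv) ?(vge_nat hv) ?rpred_nat //;
      by case: eqP => _; rewrite ?rpred0 ?vge0.
  + exact: monicXsubC.
  + by rewrite hornerXsubC inME hd andbT rpredB // (subvP sK0).
  + exists 0, 1%:P; split=> // [i|i]; first by rewrite coef0 inOE rpred0 vge0.
    by rewrite derivXsubC mul0r add0r mulr1 subrr coef0 inME rpred0 vge0.
- split.
  + apply: (res_indep_degree (y := alpha) hv) => //; first exact: subvf.
      by rewrite inOE memvf.
    by rewrite -dim_fixedField cH.
  exists alpha; split; first by rewrite inOE memvf.
    exists t, (galNorm (fixedField H) {:L} alpha).
    by split; rewrite ?inME ?memvf ?(vgeBC hv _ (alpha ^+ _)) -?cH.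
  move=> x /inOP[_ /alphaP[q hq Dx]]; exists q; split.
    exact: polyOS (sub1v _) hq.
  by rewrite Dx subrr inME rpred0 vge0.
Qed.
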